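(* (a) For any data, the merge-based algorithm (Algorithm 4 below) with threshold $d_{th}$ terminates after a finite number of iterations. (b) Suppose the data model satisfies Assumption A with the same $d_{th}$ used by the algorithm and constants $a_1,a_2,a_3\ge0$, $b>0$. Then for every integer $T\ge0$, the probability that the partition after $T$ iterations (the final partition, if it terminated earlier) is incorrect is at most $$M^2\big((T+1)a_1+a_2+(T+1)a_3\big)e^{-bn}.$$
   Context: Setting: $\mathcal{P}_1,\dots,\mathcal{P}_K$ are sets (''distribution clusters'') of probability distributions, $K$ unknown to the algorithm; $d$ is a symmetric real-valued function used both between distributions and between finite sequences. $d(\mathcal{P}_k)=\sup_{p,p'\in\mathcal{P}_k}d(p,p')$, $d(\mathcal{P}_k,\mathcal{P}_{k'})=\inf_{p\in\mathcal{P}_k,q\in\mathcal{P}_{k'}}d(p,q)$, $d_L=\max_kd(\mathcal{P}_k)$, $d_H=\min_{k\ne k'}d(\mathcal{P}_k,\mathcal{P}_{k'})$. For each $k$, $M_k\ge1$ sequences $\mathbf{x}_{k,j}$, each of $n$ i.i.d. samples from some $p_{k,j}\in\mathcal{P}_k$, all mutually independent; $M=\sum M_k$; the algorithm receives the unlabeled collection $\mathbf{y}_1,\dots,\mathbf{y}_M$. A partition is correct iff it equals $\{\{\mathbf{x}_{k,j}:j\}:k=1..K\}$. Assumption A (with $d_{th}$, $a_1,a_2,a_3$, $b>0$): $d_L<d_H$, $d_{th}\in(d_L,d_H)$, and for all $k\ne k'$, $j,j_1,j_2\le M_k$, $j'\le M_{k'}$: $P(d(\mathbf{x}_{k,j},\mathbf{x}_{k',j'})\le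 d_{th})\le a_1e^{-bn}$; for $j_1\ne j_2$, $P(d(\mathbf{x}_{k,j_1},\mathbf{x}_{k,j_2})>d_{th})\le a_2e^{-bn}$; and ($j_1,j_2$ not necessarily distinct) $P(d(\mathbf{x}_{k,j_1},\mathbf{x}_{k,j_2})\ge d(\mathbf{x}_{k,j_1},\mathbf{x}_{k',j'}))\le a_3e^{-bn}$. Algorithm 4 (ties arbitrary). Initialization (Algorithm 3): choose any $\mathbf{y}_i$ as $\mathbf{c}_1$, $\hat K=1$; while some sequence has distance greater than $d_{th}$ to every current center, add $\mathbf{c}_{\hat K+1}=\arg\max_{\mathbf{y}_i}\min_{k\le\hat K}d(\mathbf{y}_i,\mathbf{c}_k)$ and set $\hat K\leftarrow\hat K+1$; then assign each sequence to its nearest center. Each iteration: (center update) $\mathbf{c}_k=\arg\min_{\mathbf{y}\in\mathcal{C}_k}\sum_{\mathbf{y}'\in\mathcal{C}_k}d(\mathbf{y},\mathbf{y}')$ for each current cluster; (merge step) for each pair of distinct current clusters $k_1,k_2$ with $d(\mathbf{c}_{k_1},\mathbf{c}_{k_2})\le d_{th}$: if $\sum_{\mathbf{y}\in\mathcal{C}_{k_1}}d(\mathbf{c}_{k_2},\mathbf{y})<\sum_{\mathbf{y}\in\mathcal{C}_{k_2}}d(\mathbf{c}_{k_1},\mathbf{y})$, replace $\mathcal{C}_{k_2}$ by $\mathcal{C}_{k_1}\cup\mathcal{C}_{k_2}$ (center $\mathbf{c}_{k_2}$) and delete cluster $k_1$, otherwise replace $\mathcal{C}_{k_1}$ by the union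 (center $\mathbf{c}_{k_1}$) and delete cluster $k_2$; $\hat K\leftarrow\hat K-1$; (cluster update) for each $i$, if $\mathbf{y}_i\in\mathcal{C}_{k'}$ and $d(\mathbf{y}_i,\mathbf{c}_k)<d(\mathbf{y}_i,\mathbf{c}_{k'})$, move $\mathbf{y}_i$ to $\mathcal{C}_k$. Stops when an iteration changes nothing; ''after 0 iterations'' means after initialization. *)

(* Defs.v *)
From Stdlib Require Import Reals List Arith Bool.
Open Scope bool_scope.
Import ListNotations.
Open Scope R_scope.

Definition Rleb (x y : R) : bool := if Rle_dec x y then true else false.
Definition Rltb (x y : R) : bool := if Rlt_dec x y then true else false.

Definition sumR {A : Type} (f : A -> R) (l : list A) : R :=
  fold_right (fun a s => f a + s) 0 l.

Fixpoint prodR (m : nat) (f : nat -> R) : R :=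
  match m with
  | O => 1
  | S m' => prodR m' f * f m'
  end.

Definition minR_list (f : nat -> R) (l : list nat) : R :=
  match l with
  | [] => 0
  | c :: l' => fold_right (fun c' m => Rmin (f c') m) (f c) l'
  end.

Definition argmin_set (f : nat -> R) (l : list nat) : list nat :=
  filter (fun c => forallb (fun c' => Rleb (f c) (f c')) l) l.
Definition argmax_set (f : nat -> R) (l : list nat) : list nat :=
  filter (fun c => forallb (fun c' => Rleb (f c') (f c)) l) l.

(* Every arbitrary choice made by the algorithm is resolved by a fixed
   selection rule, which sees the kind of choice and the list of tied
   candidates (indices of sequences). *)
Inductive choice_point : Type :=
  | CFirst            (* choice of c_1 among all sequences *)
  | CInitMax          (* argmax in the initialisation loop *)
  | CAssign (i : nat) (* nearest centre for y_i at the end of initialisation *)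
  | CMedoid           (* argmin in the centre update *)
  | CMove (i : nat).  (* nearest centre for y_i in the cluster update *)

Definition sel_ok (sel : choice_point -> list nat -> nat) : Prop :=
  forall cp l, l <> [] -> In (sel cp l) l.
Definition selp_ok (selp : list (nat * nat) -> nat * nat) : Prop :=
  forall l, l <> [] -> In (selp l) l.

(* A state is a list [a] of length M: [nth i a 0] is the index of the centre
   of the cluster containing y_i.  Clusters are identified with (the index of)
   their centres: the clusters are the nonempty sets {i | a_i = c}. *)
Section Algo.
Context {X : Type} (d : X -> X -> R) (dth : R) (M : nat) (y : nat -> X)
  (sel : choice_point -> list nat -> nat) (selp : list (nat * nat) -> nat * nat).

Definition idx : list nat := seq 0 M.
Definition cur (a : list nat) (i : nat) : nat := nth i a 0%nat.
Definition centers (a : list nat) : list nat := nodup Nat.eq_dec a.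
Definition members (a : list nat) (c : nat) : list nat :=
  filter (fun i => Nat.eqb (cur a i) c) idx.

(* Algorithm 3: initialisation.  The while loop adds a new (distinct) sequence
   at each round, so M rounds of fuel always suffice under the standing
   hypotheses. *)
Fixpoint grow (fuel : nat) (cs : list nat) : list nat :=
  match fuel with
  | O => cs
  | S f =>
      if existsb (fun i => forallb (fun c => Rltb dth (d (y i) (y c))) cs) idx
      then grow f (cs ++ [sel CInitMax
                            (argmax_set (fun i => minR_list (fun c => d (y i) (y c)) cs) idx)])
      else cs
  end.

Definition init_centers : list nat := grow M [sel CFirst idx].

Definition init_state : list nat :=
  map (fun i => sel (CAssign i) (argmin_set (fun c => d (y i) (y c)) init_centers)) idx.

Definition center_update (a : list nat) : list nat :=
  let newc c := sel CMedoid
       (argmin_set (fun z => sumR (fun i => d (y z) (y i)) (members a c)) (members a c)) in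
  map newc a.

Definition eligible (a : list nat) : list (nat * nat) :=
  filter (fun pr => negb (Nat.eqb (fst pr) (snd pr)) && Rleb (d (y (fst pr)) (y (snd pr))) dth)
         (list_prod (centers a) (centers a)).

Definition merge_one (a : list nat) (pr : nat * nat) : list nat :=
  let c1 := fst pr in let c2 := snd pr in
  let S1 := sumR (fun i => d (y c2) (y i)) (members a c1) in
  let S2 := sumR (fun i => d (y c1) (y i)) (members a c2) in
  let w := if Rltb S1 S2 then c2 else c1 in
  map (fun c => if Nat.eqb c c1 || Nat.eqb c c2 then w else c) a.

(* each merge removes one cluster, so M rounds of fuel always suffice *)
Fixpoint merge_loop (fuel : nat) (a : list nat) : list nat :=
  match fuel with
  | O => a
  | S f =>
      match eligible a with
      | [] => a
      | prs => merge_loop f (merge_one a (selp prs))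
      end
  end.

Definition merge_step (a : list nat) : list nat := merge_loop M a.

Definition cluster_update (a : list nat) : list nat :=
  let cs := centers a in
  map (fun i =>
         if existsb (fun c => Rltb (d (y i) (y c)) (d (y i) (y (cur a i)))) cs
         then sel (CMove i) (argmin_set (fun c => d (y i) (y c)) cs)
         else cur a i) idx.

Definition iteration (a : list nat) : list nat :=
  cluster_update (merge_step (center_update a)).

(* state after T iterations (0 iterations = after initialisation); once the
   algorithm has stopped (iteration changes nothing) the state stays fixed *)
Definition run (T : nat) : list nat := Nat.iter T iteration init_state.

End Algo.

(* The partition encoded by state [a] equals the true partition
   {{i | lab i = k} : k < K} (as a set of subsets of {0..M-1}). *)
Definition correct_partition (M K : nat) (lab : nat -> nat) (a : list nat) : Prop :=
  (forall c, In c a -> exists k, (k < K)%nat /\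
       forall i, (i < M)%nat -> (nth i a 0%nat = c <-> lab i = k)) /\
  (forall k, (k < K)%nat -> exists c, In c a /\
       forall i, (i < M)%nat -> (nth i a 0%nat = c <-> lab i = k)).

(* A (finitely additive) probability on all subsets of T. *)
Record charge (T : Type) : Type := {
  mass :> (T -> Prop) -> R;
  mass_nonneg : forall A, 0 <= mass A;
  mass_total : mass (fun _ => True) = 1;
  mass_add : forall A B : T -> Prop, (forall t, A t -> B t -> False) ->
               mass (fun t => A t \/ B t) = mass A + mass B
}.
Arguments mass {T}.

(* The sequence y_i : its n samples X i 0, ..., X i (n-1). *)
Definition data {S Omega : Type} (n : nat) (Xs : nat -> nat -> Omega -> S)
  (i : nat) (w : Omega) : list S :=
  map (fun t => Xs i t w) (seq 0 n).

Definition iid_model {S Omega : Type} (Pr : charge Omega) (M n : nat)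
  (p : nat -> charge S) (Xs : nat -> nat -> Omega -> S) : Prop :=
  forall A : nat -> nat -> S -> Prop,
    Pr (fun w => forall i t, (i < M)%nat -> (t < n)%nat -> A i t (Xs i t w)) =
    prodR M (fun i => prodR n (fun t => p i (A i t))).

(* d_L < d_th < d_H, with d_L = max_k sup_{q,q' in P_k} dP q q' and
   d_H = min_{k<>k'} inf_{q in P_k, q' in P_k'} dP q q' written out. *)
Definition threshold_separates {D : Type} (K : nat) (Pc : nat -> D -> Prop)
  (dP : D -> D -> R) (dth : R) : Prop :=
  exists L H, L < dth /\ dth < H /\
    (forall k q q', (k < K)%nat -> Pc k q -> Pc k q' -> dP q q' <= L) /\
    (forall k k' q q', (k < K)%nat -> (k' < K)%nat -> k <> k' ->
        Pc k q -> Pc k' q' -> H <= dP q q').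

Definition assumptionA_bounds {Y Omega : Type} (Pr : charge Omega) (M n : nat)
  (lab : nat -> nat) (yr : nat -> Omega -> Y) (d : Y -> Y -> R)
  (dth a1 a2 a3 b : R) : Prop :=
  (forall i i', (i < M)%nat -> (i' < M)%nat -> lab i <> lab i' ->
     Pr (fun w => d (yr i w) (yr i' w) <= dth) <= a1 * exp (- (b * INR n))) /\
  (forall i1 i2, (i1 < M)%nat -> (i2 < M)%nat -> i1 <> i2 -> lab i1 = lab i2 ->
     Pr (fun w => d (yr i1 w) (yr i2 w) > dth) <= a2 * exp (- (b * INR n))) /\
  (forall i1 i2 i', (i1 < M)%nat -> (i2 < M)%nat -> (i' < M)%nat ->
     lab i1 = lab i2 -> lab i' <> lab i1 ->
     Pr (fun w => d (yr i1 w) (yr i2 w) >= d (yr i1 w) (yr i' w))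
       <= a3 * exp (- (b * INR n))).

(* Main.v *)
Require Import Defs.
From Stdlib Require Import Reals List Arith.
From Stdlib Require Import Lia Lra Classical FunctionalExtensionality PropExtensionality Permutation.
Import ListNotations.
Open Scope R_scope.

(* A state lists, for each of the M sequences, the index of its centre.  After
   the first iteration every state is well formed (entries below M) and
   centred (each centre is its own centre).

   On centred states an iteration never increases the number
   of clusters; if it keeps that number no merge happened, and then it never
   increases the cost (total distance of the sequences to their centres); if it
   also keeps the cost, the cluster update moved nothing, so the step was a
   mere centre update.  There are finitely many states, so the run revisits a
   state; along that cycle both potentials are constant, every step is a
   centre update, and centre updates are idempotent.

   Call the data separated when sequences with different
   labels are farther apart than d_th and sequences with the same label are
   not.  On separated data the initialisation returns the true partition and
   each iteration preserves it.  An incorrect partition therefore needs one of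
   M^2 pairwise violations, each of probability at most (a1 + a2) e^{-bn} by
   Assumption A; the union bound gives M^2 (a1 + a2) e^{-bn}, which is below
   the bound claimed in the theorem. *)

Lemma Rleb_true x y : Rleb x y = true <-> x <= y.
Proof. unfold Rleb; destruct (Rle_dec x y); split; intros; auto; try discriminate; contradiction. Qed.

Lemma Rltb_true x y : Rltb x y = true <-> x < y.
Proof. unfold Rltb; destruct (Rlt_dec x y); split; intros; auto; try discriminate; contradiction. Qed.

Lemma sumR_cons {A} (f : A -> R) x l : sumR f (x :: l) = f x + sumR f l.
Proof. reflexivity. Qed.

Lemma sumR_le {A} (f g : A -> R) l :
  (forall x, In x l -> f x <= g x) -> sumR f l <= sumR g l.
Proof.
  induction l as [|a l IH]; intros H; [simpl; lra|].
  rewrite !sumR_cons.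
  assert (f a <= g a) by (apply H; left; auto).
  assert (sumR f l <= sumR g l) by (apply IH; intros; apply H; right; auto).
  lra.
Qed.

Lemma sumR_lt {A} (f g : A -> R) l :
  (forall x, In x l -> f x <= g x) -> (exists x, In x l /\ f x < g x) ->
  sumR f l < sumR g l.
Proof.
  induction l as [|a l IH]; intros H [x [Hx Hlt]]; [contradiction|].
  rewrite !sumR_cons. destruct Hx as [<-|Hx].
  - assert (sumR f l <= sumR g l) by (apply sumR_le; intros; apply H; right; auto). lra.
  - assert (f a <= g a) by (apply H; left; auto).
    assert (sumR f l < sumR g l) by (apply IH; [intros; apply H; right; auto | eauto]). lra.
Qed.

Lemma sumR_ext_in {A} (f g : A -> R) l :
  (forall x, In x l -> f x = g x) -> sumR f l = sumR g l.
Proof. intros H; apply Rle_antisym; apply sumR_le; intros x Hx; rewrite (H x Hx); lra. Qed.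

Lemma sumR_plus {A} (f g : A -> R) l :
  sumR (fun x => f x + g x) l = sumR f l + sumR g l.
Proof. induction l as [|a l IH]; [simpl; lra|]. rewrite !sumR_cons, IH. lra. Qed.

Lemma sumR_const {A} (c : R) (l : list A) : sumR (fun _ => c) l = INR (length l) * c.
Proof.
  induction l as [|a l IH]; [simpl; lra|].
  rewrite sumR_cons, IH. change (length (a :: l)) with (S (length l)). rewrite S_INR. lra.
Qed.

Lemma sumR_indicator (v : nat) (r : R) cs :
  NoDup cs -> In v cs -> sumR (fun c => if Nat.eqb v c then r else 0) cs = r.
Proof.
  assert (Hout : forall l, ~ In v l -> sumR (fun c => if Nat.eqb v c then r else 0) l = 0).
  { induction l as [|c l IH]; intros Hn; [reflexivity|]. rewrite sumR_cons, IH by (simpl in Hn; tauto).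
    destruct (Nat.eqb_spec v c); [subst; simpl in Hn; tauto | lra]. }
  induction cs as [|c cs IH]; intros Hnd Hin; [contradiction|].
  inversion Hnd as [|? ? Hc Hnd']; subst. rewrite sumR_cons. destruct Hin as [->|Hin].
  - rewrite Nat.eqb_refl, Hout by auto. lra.
  - destruct (Nat.eqb_spec v c); [subst; contradiction|]. rewrite IH by auto. lra.
Qed.

Lemma sumR_group (h : nat -> nat) (f : nat -> R) l cs :
  NoDup cs -> (forall x, In x l -> In (h x) cs) ->
  sumR f l = sumR (fun c => sumR f (filter (fun x => Nat.eqb (h x) c) l)) cs.
Proof.
  intros Hnd. induction l as [|x l IH]; intros Hin.
  - simpl. rewrite sumR_const. lra.
  - rewrite sumR_cons, IH by (intros; apply Hin; right; auto).
    rewrite <- (sumR_indicator (h x) (f x) cs Hnd (Hin x (or_introl eq_refl))), <- sumR_plus.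
    apply sumR_ext_in. intros c _. simpl. destruct (Nat.eqb (h x) c); rewrite ?sumR_cons; lra.
Qed.

Lemma exists_min (f : nat -> R) l :
  l <> [] -> exists z, In z l /\ forall c, In c l -> f z <= f c.
Proof.
  induction l as [|a l IH]; intros H; [congruence|].
  destruct l as [|b l].
  { exists a; split; [left; auto|]. intros c [<-|[]]; lra. }
  destruct IH as [z [Hz Hm]]; [congruence|].
  destruct (Rle_dec (f a) (f z)).
  - exists a; split; [left; auto|]. intros c [<-|Hc]; [lra|]. specialize (Hm c Hc); lra.
  - exists z; split; [right; auto|]. intros c [<-|Hc]; [lra|auto].
Qed.

Lemma sel_argmin (sel : choice_point -> list nat -> nat) cp (f : nat -> R) l :
  sel_ok sel -> l <> [] ->
  In (sel cp (argmin_set f l)) l /\ forall c, In c l -> f (sel cp (argmin_set f l)) <= f c.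
Proof.
  intros Hs Hl. unfold argmin_set.
  destruct (exists_min f l Hl) as [z [Hz Hm]].
  assert (Hz' : In z (filter (fun c => forallb (fun c' => Rleb (f c) (f c')) l) l)).
  { apply filter_In; split; auto. apply forallb_forall; intros; apply Rleb_true; auto. }
  assert (Hsel := Hs cp _ ltac:(intros E; rewrite E in Hz'; contradiction)).
  apply filter_In in Hsel. destruct Hsel as [H1 H2]. rewrite forallb_forall in H2.
  split; auto. intros c Hc; apply Rleb_true; auto.
Qed.

Lemma sel_argmax (sel : choice_point -> list nat -> nat) cp (f : nat -> R) l :
  sel_ok sel -> l <> [] ->
  In (sel cp (argmax_set f l)) l /\ forall c, In c l -> f c <= f (sel cp (argmax_set f l)).
Proof.
  intros Hs Hl. unfold argmax_set.
  destruct (exists_min (fun x => - f x) l Hl) as [z [Hz Hm]].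
  assert (Hz' : In z (filter (fun c => forallb (fun c' => Rleb (f c') (f c)) l) l)).
  { apply filter_In; split; auto. apply forallb_forall; intros c Hc; apply Rleb_true.
    specialize (Hm c Hc); lra. }
  assert (Hsel := Hs cp _ ltac:(intros E; rewrite E in Hz'; contradiction)).
  apply filter_In in Hsel. destruct Hsel as [H1 H2]. rewrite forallb_forall in H2.
  split; auto. intros c Hc; apply Rleb_true; auto.
Qed.

Lemma nonincreasing_cycle (g : nat -> R) i j :
  (forall m, (i <= m < j)%nat -> g (S m) <= g m) -> g j = g i ->
  forall m, (i <= m < j)%nat -> g (S m) = g m.
Proof.
  intros Hdec Hij.
  assert (Hchain : forall m m', (i <= m <= m')%nat -> (m' <= j)%nat -> g m' <= g m).
  { intros m m' Hm Hj. induction m' as [|m' IH].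
    - replace m with 0%nat by lia. lra.
    - destruct (Nat.eq_dec m (S m')) as [->|Hne]; [lra|].
      specialize (Hdec m' ltac:(lia)). assert (g m' <= g m) by (apply IH; lia). lra. }
  intros m Hm. assert (g j <= g (S m)) by (apply Hchain; lia).
  assert (g m <= g i) by (apply Hchain; lia). specialize (Hdec m Hm). lra.
Qed.

Lemma minR_list_gt (f : nat -> R) t cs :
  cs <> [] -> (t < minR_list f cs <-> forall c, In c cs -> t < f c).
Proof.
  destruct cs as [|c l]; intros H; [congruence|]. clear H. unfold minR_list.
  assert (Hfold : t < fold_right (fun c' m => Rmin (f c') m) (f c) l <->
                  t < f c /\ forall c', In c' l -> t < f c').
  { induction l as [|a l IH]; simpl; [split; [intros; split; [auto|intros _ []] | tauto]|].
    split.
    - intros Hlt. assert (t < f a) by (eapply Rlt_le_trans; [exact Hlt | apply Rmin_l]).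
      assert (Hr : t < fold_right (fun c' m => Rmin (f c') m) (f c) l)
        by (eapply Rlt_le_trans; [exact Hlt | apply Rmin_r]).
      apply IH in Hr. destruct Hr as [H1 H2]. split; auto. intros c' [<-|Hc]; auto.
    - intros [H1 H2]. apply Rmin_glb_lt; [apply H2; left; auto|]. apply IH. split; auto. }
  rewrite Hfold. split.
  - intros [H1 H2] c' [<-|Hc]; auto.
  - intros H'; split; [apply H'; left | intros; apply H'; right]; auto.
Qed.

Lemma in_idx M i : In i (idx M) <-> (i < M)%nat.
Proof. unfold idx; rewrite in_seq; lia. Qed.

Lemma idx_nonempty M : (0 < M)%nat -> idx M <> [].
Proof. intros HM. unfold idx. destruct M; [lia|]. simpl; congruence. Qed.

Lemma nth_map_lt (F : nat -> nat) l i d0 :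
  (i < length l)%nat -> nth i (map F l) d0 = F (nth i l 0%nat).
Proof. intros H. rewrite nth_indep with (d' := F 0%nat) by (rewrite length_map; auto). apply map_nth. Qed.

Lemma cur_map_idx (F : nat -> nat) M i : (i < M)%nat -> cur (map F (idx M)) i = F i.
Proof. intros H. unfold cur, idx. rewrite nth_map_lt by (rewrite length_seq; auto). rewrite seq_nth; auto. Qed.

Lemma map_cur_idx a M : length a = M -> map (cur a) (idx M) = a.
Proof.
  intros H. apply nth_ext with (d := 0%nat) (d' := 0%nat).
  - unfold idx; rewrite length_map, length_seq; auto.
  - intros n Hn. unfold idx in *. rewrite length_map, length_seq in Hn.
    rewrite nth_map_lt by (rewrite length_seq; auto). rewrite seq_nth by auto. reflexivity.
Qed.

Lemma NoDup_map_eq {A} (f : A -> nat) l x x' :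
  NoDup (map f l) -> In x l -> In x' l -> f x = f x' -> x = x'.
Proof.
  induction l as [|a l IH]; simpl; intros Hnd H1 H2 He; [contradiction|]. inversion Hnd; subst.
  destruct H1 as [<-|H1], H2 as [<-|H2]; auto.
  - exfalso. match goal with H : ~ In _ _ |- _ => apply H end. rewrite He; apply in_map; auto.
  - exfalso. match goal with H : ~ In _ _ |- _ => apply H end. rewrite <- He; apply in_map; auto.
Qed.

Lemma NoDup_bounded_length (l : list nat) K :
  NoDup l -> (forall x, In x l -> (x < K)%nat) -> (length l <= K)%nat.
Proof.
  intros Hnd Hb. rewrite <- (length_seq K 0). apply NoDup_incl_length; auto.
  intros x Hx; apply in_seq; specialize (Hb x Hx); lia.
Qed.

Lemma centers_incl (a b : list nat) : incl b a -> (length (centers b) <= length (centers a))%nat.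
Proof.
  intros H. apply NoDup_incl_length; [apply NoDup_nodup|].
  intros x Hx. apply nodup_In. apply nodup_In in Hx; auto.
Qed.

Lemma centers_map (F : nat -> nat) a : (length (centers (map F a)) <= length (centers a))%nat.
Proof.
  rewrite <- (length_map F (centers a)). apply NoDup_incl_length; [apply NoDup_nodup|].
  intros x Hx. apply nodup_In in Hx. apply in_map_iff in Hx. destruct Hx as [z [<- Hz]].
  apply in_map, nodup_In; auto.
Qed.

Section States.
Variable M : nat.

Definition well_formed (a : list nat) : Prop := length a = M /\ forall x, In x a -> (x < M)%nat.
Definition centred (a : list nat) : Prop := forall i, (i < M)%nat -> cur a (cur a i) = cur a i.

Lemma in_members a c j : In j (members M a c) <-> (j < M)%nat /\ cur a j = c.
Proof. unfold members. rewrite filter_In, in_idx, Nat.eqb_eq. tauto. Qed.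

Lemma In_cur a i : length a = M -> (i < M)%nat -> In (cur a i) a.
Proof. intros H Hi. unfold cur. apply nth_In. lia. Qed.

Lemma cur_onto a x : length a = M -> In x a -> exists i, (i < M)%nat /\ cur a i = x.
Proof. intros H Hx. destruct (In_nth a x 0%nat Hx) as [i [Hi He]]. exists i; split; [lia|auto]. Qed.

Lemma centre_fixed a x : well_formed a -> centred a -> In x a -> cur a x = x.
Proof. intros [Hl Hb] Hf Hx. destruct (cur_onto a x Hl Hx) as [i [Hi <-]]. apply Hf; auto. Qed.

(* Merging the clusters of centres [c1] and [c2] into the one of [w]. *)
Definition redirect (c1 c2 w : nat) (c : nat) : nat :=
  if Nat.eqb c c1 || Nat.eqb c c2 then w else c.

Lemma redirect_invariants a c1 c2 w :
  well_formed a -> centred a -> In w a ->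
  well_formed (map (redirect c1 c2 w) a) /\ centred (map (redirect c1 c2 w) a).
Proof.
  intros [Hl Hb] Hf Hw.
  assert (Hin : forall v, In v a -> In (redirect c1 c2 w v) a).
  { intros v Hv. unfold redirect. destruct (_ || _); auto. }
  assert (Hcur : forall v, (v < M)%nat -> cur (map (redirect c1 c2 w) a) v = redirect c1 c2 w (cur a v)).
  { intros v Hv. unfold cur. apply nth_map_lt. lia. }
  split; [split|].
  - rewrite length_map; auto.
  - intros x Hx. apply in_map_iff in Hx. destruct Hx as [v [<- Hv]]. apply Hb, Hin; auto.
  - intros i Hi. assert (Hv : In (redirect c1 c2 w (cur a i)) a) by (apply Hin, In_cur; auto).
    rewrite (Hcur i Hi), (Hcur _ (Hb _ Hv)), (centre_fixed a _ (conj Hl Hb) Hf Hv).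
    unfold redirect. destruct (Nat.eqb (cur a i) c1 || Nat.eqb (cur a i) c2) eqn:E; [|rewrite E; auto].
    destruct (Nat.eqb w c1 || Nat.eqb w c2); auto.
Qed.

Lemma redirect_fewer a c1 c2 w :
  c1 <> c2 -> In c1 a -> In c2 a -> (w = c1 \/ w = c2) ->
  (length (centers (map (redirect c1 c2 w) a)) < length (centers a))%nat.
Proof.
  intros Hne H1 H2 Hw. set (lo := if Nat.eq_dec w c1 then c2 else c1).
  assert (Hlo : In lo a /\ lo <> w) by (unfold lo; destruct Nat.eq_dec; split; auto; destruct Hw; congruence).
  apply Nat.le_lt_trans with (length (remove Nat.eq_dec lo (centers a))).
  - apply NoDup_incl_length; [apply NoDup_nodup|]. intros x Hx. apply nodup_In in Hx.
    apply in_map_iff in Hx. destruct Hx as [v [<- Hv]]. apply in_in_remove.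
    + unfold redirect, lo. destruct (Nat.eqb_spec v c1), (Nat.eqb_spec v c2); simpl;
        destruct Nat.eq_dec; destruct Hw; congruence.
    + apply nodup_In. unfold redirect. destruct (_ || _); destruct Hw; subst; auto.
  - apply remove_length_lt. apply nodup_In. tauto.
Qed.

Fixpoint all_lists (k : nat) : list (list nat) :=
  match k with
  | O => [[]]
  | S k' => flat_map (fun x => map (cons x) (all_lists k')) (seq 0 M)
  end.

Lemma all_lists_complete l : (forall x, In x l -> (x < M)%nat) -> In l (all_lists (length l)).
Proof.
  induction l as [|a l IH]; intros H; simpl; auto.
  apply in_flat_map. exists a. split.
  - apply in_seq. specialize (H a (or_introl eq_refl)). lia.
  - apply in_map, IH. intros; apply H; right; auto.
Qed.

(* Pigeonhole principle: there are finitely many well-formed states, so any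
   sequence of them repeats. *)
Lemma well_formed_repeat (s : nat -> list nat) :
  (forall m, well_formed (s m)) -> exists i j, (i < j)%nat /\ s i = s j.
Proof.
  intros H. apply NNPP. intros Hn.
  assert (Hnd : forall k a, NoDup (map s (seq a k))).
  { induction k as [|k IH]; intros a; simpl; constructor; auto.
    intros Hin. apply in_map_iff in Hin. destruct Hin as [j [Hj Hjs]]. apply in_seq in Hjs.
    apply Hn. exists a, j. split; [lia|auto]. }
  set (B := length (all_lists M)).
  assert (Hle : (length (map s (seq 0 (S B))) <= B)%nat).
  { apply NoDup_incl_length; [apply Hnd|]. intros l Hl. apply in_map_iff in Hl.
    destruct Hl as [m [<- _]]. destruct (H m) as [Hl Hb]. unfold B. rewrite <- Hl. apply all_lists_complete; auto. }
  rewrite length_map, length_seq in Hle. lia.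
Qed.

End States.

Section Algorithm.
Context {X : Type}.
Variables (d : X -> X -> R) (dth : R) (M : nat) (y : nat -> X).
Variables (sel : choice_point -> list nat -> nat) (selp : list (nat * nat) -> nat * nat).
Hypothesis sel_good : sel_ok sel.

Definition cost (a : list nat) : R := sumR (fun i => d (y i) (y (cur a i))) (idx M).

Lemma cost_by_cluster a b : length a = M ->
  cost b = sumR (fun c => sumR (fun i => d (y i) (y (cur b i))) (members M a c)) (centers a).
Proof.
  intros Hl. unfold cost. apply sumR_group; [apply NoDup_nodup|].
  intros x Hx. apply in_idx in Hx. apply nodup_In, (In_cur M); auto.
Qed.

Definition medoid (a : list nat) (c : nat) : nat :=
  sel CMedoid (argmin_set (fun z => sumR (fun i => d (y z) (y i)) (members M a c)) (members M a c)).

Lemma medoid_spec a v : length a = M -> In v a ->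
  ((medoid a v < M)%nat /\ cur a (medoid a v) = v) /\
  forall c, In c (members M a v) ->
    sumR (fun i => d (y (medoid a v)) (y i)) (members M a v)
    <= sumR (fun i => d (y c) (y i)) (members M a v).
Proof.
  intros Hl Hv. destruct (cur_onto M a v Hl Hv) as [i [Hi Hc]].
  assert (Hne : members M a v <> []).
  { intros He. assert (Hm : In i (members M a v)) by (apply in_members; auto). rewrite He in Hm; auto. }
  destruct (sel_argmin sel CMedoid (fun z => sumR (fun i => d (y z) (y i)) (members M a v)) _
              sel_good Hne) as [Hz Hmin].
  split; [apply (in_members M a v), Hz | exact Hmin].
Qed.

Lemma center_update_eq a : center_update d M y sel a = map (medoid a) a.
Proof. reflexivity. Qed.

Lemma cur_center_update a i : length a = M -> (i < M)%nat ->
  cur (center_update d M y sel a) i = medoid a (cur a i).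
Proof. intros Hl Hi. rewrite center_update_eq. unfold cur. apply nth_map_lt. lia. Qed.

(* The medoids are sequences of their own clusters, so the new state is centred. *)
Lemma center_update_invariants a : well_formed M a ->
  well_formed M (center_update d M y sel a) /\ centred M (center_update d M y sel a).
Proof.
  intros [Hl Hb]. split; [split|].
  - rewrite center_update_eq, length_map; auto.
  - intros x Hx. rewrite center_update_eq in Hx. apply in_map_iff in Hx.
    destruct Hx as [v [<- Hv]]. apply (medoid_spec a v Hl Hv).
  - intros i Hi. destruct (medoid_spec a (cur a i) Hl (In_cur M a i Hl Hi)) as [[Hz1 Hz2] _].
    rewrite (cur_center_update a i Hl Hi), (cur_center_update a _ Hl Hz1), Hz2. reflexivity.
Qed.

(* A second centre update changes nothing: the clusters are unchanged and the
   medoid of each cluster is recomputed from the same data. *)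
Lemma center_update_idem a : well_formed M a ->
  center_update d M y sel (center_update d M y sel a) = center_update d M y sel a.
Proof.
  intros [Hl Hb]. set (a' := center_update d M y sel a).
  rewrite (center_update_eq a'). transitivity (map (fun x => x) a'); [|apply map_id]. apply map_ext_in.
  intros x Hx. unfold a' in Hx. rewrite center_update_eq in Hx.
  apply in_map_iff in Hx. destruct Hx as [v [<- Hv]].
  assert (Hsame : forall j, (j < M)%nat -> (medoid a (cur a j) = medoid a v <-> cur a j = v)).
  { intros j Hj; split; intros E; [|rewrite E; auto].
    destruct (medoid_spec a (cur a j) Hl (In_cur M a j Hl Hj)) as [[_ H1] _].
    destruct (medoid_spec a v Hl Hv) as [[_ H2] _].
    rewrite <- H1, <- H2, E. reflexivity. }
  assert (Hm : members M a' (medoid a v) = members M a v).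
  { unfold members. apply filter_ext_in. intros j Hj. apply in_idx in Hj.
    unfold a'. rewrite (cur_center_update a j Hl Hj). specialize (Hsame j Hj).
    destruct (Nat.eqb_spec (medoid a (cur a j)) (medoid a v));
      destruct (Nat.eqb_spec (cur a j) v); tauto. }
  unfold medoid at 1. rewrite Hm. reflexivity.
Qed.

Hypothesis d_sym : forall u v, d u v = d v u.

Lemma center_update_cost a : well_formed M a -> centred M a ->
  cost (center_update d M y sel a) <= cost a.
Proof.
  intros [Hl Hb] Hf. rewrite (cost_by_cluster a _ Hl), (cost_by_cluster a a Hl).
  apply sumR_le. intros c Hc. apply nodup_In in Hc.
  destruct (medoid_spec a c Hl Hc) as [_ Hmin].
  rewrite (sumR_ext_in _ (fun i => d (y (medoid a c)) (y i))).
  2:{ intros i Hi. apply in_members in Hi. destruct Hi as [Hi Hci].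
      rewrite (cur_center_update a i Hl Hi), Hci. apply d_sym. }
  rewrite (sumR_ext_in (fun i => d (y i) (y (cur a i))) (fun i => d (y c) (y i))).
  2:{ intros i Hi. apply in_members in Hi. destruct Hi as [Hi Hci]. rewrite Hci. apply d_sym. }
  apply Hmin, in_members. split; [apply Hb; auto | apply (centre_fixed M); auto; split; auto].
Qed.

Lemma eligible_in a pr : In pr (eligible d dth y a) ->
  fst pr <> snd pr /\ In (fst pr) a /\ In (snd pr) a.
Proof.
  unfold eligible. rewrite filter_In. destruct pr as [c1 c2]. simpl.
  intros [H1 H2]. apply in_prod_iff in H1. destruct H1 as [H1 H3].
  apply Bool.andb_true_iff in H2. destruct H2 as [H2 _]. apply Bool.negb_true_iff, Nat.eqb_neq in H2.
  unfold centers in *. rewrite nodup_In in H1, H3. auto.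
Qed.

Lemma merge_one_redirect a c1 c2 :
  exists w, (w = c1 \/ w = c2) /\ merge_one d M y a (c1, c2) = map (redirect c1 c2 w) a.
Proof. unfold merge_one, redirect. simpl. destruct Rltb; eauto. Qed.

Hypothesis selp_good : selp_ok selp.

Lemma merge_loop_props f a : well_formed M a -> centred M a ->
  well_formed M (merge_loop d dth M y selp f a) /\ centred M (merge_loop d dth M y selp f a) /\
  (length (centers (merge_loop d dth M y selp f a)) <= length (centers a))%nat /\
  (eligible d dth y a <> [] -> (0 < f)%nat ->
     (length (centers (merge_loop d dth M y selp f a)) < length (centers a))%nat).
Proof.
  revert a. induction f as [|f IH]; intros a Hw Hf; simpl.
  { split; [|split; [|split]]; auto; lia. }
  destruct (eligible d dth y a) as [|p ps] eqn:E.
  { split; [|split; [|split]]; auto; congruence. }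
  assert (Hin : In (selp (p :: ps)) (eligible d dth y a)) by (rewrite E; apply selp_good; congruence).
  destruct (selp (p :: ps)) as [c1 c2]. apply eligible_in in Hin. simpl in Hin.
  destruct Hin as [Hne [H1 H2]]. destruct (merge_one_redirect a c1 c2) as [w [Hw' ->]].
  assert (Hwa : In w a) by (destruct Hw'; subst; auto).
  destruct (redirect_invariants M a c1 c2 w Hw Hf Hwa) as [Hw1 Hf1].
  pose proof (redirect_fewer a c1 c2 w Hne H1 H2 Hw').
  destruct (IH _ Hw1 Hf1) as [A [B [C _]]]. split; [|split; [|split]]; auto; lia.
Qed.

Lemma merge_loop_no_eligible f a : eligible d dth y a = [] -> merge_loop d dth M y selp f a = a.
Proof. intros E. destruct f; simpl; [|rewrite E]; reflexivity. Qed.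

Definition reassign (a : list nat) (i : nat) : nat :=
  if existsb (fun c => Rltb (d (y i) (y c)) (d (y i) (y (cur a i)))) (centers a)
  then sel (CMove i) (argmin_set (fun c => d (y i) (y c)) (centers a))
  else cur a i.

Lemma cluster_update_eq a : cluster_update d M y sel a = map (reassign a) (idx M).
Proof. reflexivity. Qed.

Lemma reassign_spec a i : length a = M -> (i < M)%nat ->
  In (reassign a i) a /\ d (y i) (y (reassign a i)) <= d (y i) (y (cur a i)) /\
  (reassign a i <> cur a i -> d (y i) (y (reassign a i)) < d (y i) (y (cur a i))).
Proof.
  intros Hl Hi. unfold reassign. destruct existsb eqn:E.
  - apply existsb_exists in E. destruct E as [c [Hc Hlt]]. apply Rltb_true in Hlt.
    destruct (sel_argmin sel (CMove i) (fun c => d (y i) (y c)) (centers a) sel_good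
                ltac:(intros He; rewrite He in Hc; auto)) as [Hz1 Hz2].
    specialize (Hz2 c Hc). unfold centers in Hz1; rewrite nodup_In in Hz1. repeat split; auto; lra.
  - repeat split; [apply (In_cur M); auto | lra | congruence].
Qed.

Hypothesis d_self : forall u v, d u u <= d u v.

(* In a centred state a centre never moves, since it is at distance
   [d u u] from its own centre. *)
Lemma reassign_centre a v : well_formed M a -> centred M a -> In v a -> reassign a v = v.
Proof.
  intros Hw Hf Hv. pose proof (centre_fixed M a v Hw Hf Hv) as Hc. unfold reassign.
  destruct existsb eqn:E; auto. apply existsb_exists in E. destruct E as [c [_ Hlt]].
  apply Rltb_true in Hlt. rewrite Hc in Hlt. specialize (d_self (y v) (y c)). lra.
Qed.

(* Sequences only move to existing centres, and centres stay put. *)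
Lemma cluster_update_invariants a : well_formed M a -> centred M a ->
  well_formed M (cluster_update d M y sel a) /\ centred M (cluster_update d M y sel a) /\
  (length (centers (cluster_update d M y sel a)) <= length (centers a))%nat.
Proof.
  intros Hw Hf. pose proof Hw as [Hl Hb]. rewrite cluster_update_eq.
  assert (Hin : incl (map (reassign a) (idx M)) a).
  { intros x Hx. apply in_map_iff in Hx. destruct Hx as [i [<- Hi]]. apply in_idx in Hi.
    apply (reassign_spec a i Hl Hi). }
  split; [split|split].
  - unfold idx; rewrite length_map, length_seq; auto.
  - intros x Hx. apply Hb, Hin; auto.
  - intros i Hi. pose proof (proj1 (reassign_spec a i Hl Hi)).
    rewrite (cur_map_idx _ M i Hi), cur_map_idx by (apply Hb; auto).
    apply reassign_centre; auto.
  - apply centers_incl, Hin.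
Qed.

Lemma cluster_update_cost a : length a = M ->
  cost (cluster_update d M y sel a) <= cost a /\
  (cluster_update d M y sel a <> a -> cost (cluster_update d M y sel a) < cost a).
Proof.
  intros Hl. rewrite cluster_update_eq.
  assert (Hcost : cost (map (reassign a) (idx M)) = sumR (fun i => d (y i) (y (reassign a i))) (idx M)).
  { unfold cost. apply sumR_ext_in. intros i Hi. apply in_idx in Hi. rewrite cur_map_idx; auto. }
  assert (Hle : forall i, In i (idx M) -> d (y i) (y (reassign a i)) <= d (y i) (y (cur a i))).
  { intros i Hi. apply in_idx in Hi. apply (reassign_spec a i Hl Hi). }
  rewrite Hcost. unfold cost. split; [apply sumR_le, Hle|].
  intros Hne. apply sumR_lt; [apply Hle|].
  apply NNPP. intros Hn. apply Hne. rewrite <- (map_cur_idx a M Hl) at 2. apply map_ext_in.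
  intros i Hi. apply NNPP; intros Hne'. apply Hn. exists i. split; auto.
  apply in_idx in Hi. apply (reassign_spec a i Hl Hi); auto.
Qed.

Lemma iteration_eq a : iteration d dth M y sel selp a =
  cluster_update d M y sel (merge_loop d dth M y selp M (center_update d M y sel a)).
Proof. reflexivity. Qed.

Lemma iteration_invariants a : well_formed M a ->
  well_formed M (iteration d dth M y sel selp a) /\ centred M (iteration d dth M y sel selp a).
Proof.
  intros Hw. rewrite iteration_eq.
  destruct (center_update_invariants a Hw) as [W1 F1].
  destruct (merge_loop_props M _ W1 F1) as [W2 [F2 _]].
  destruct (cluster_update_invariants _ W2 F2) as [W3 [F3 _]]. auto.
Qed.

Hypothesis M_pos : (0 < M)%nat.

Lemma iteration_descent a : well_formed M a -> centred M a ->
  let a' := iteration d dth M y sel selp a in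
  (length (centers a') <= length (centers a))%nat /\
  (length (centers a') = length (centers a) ->
     cost a' <= cost a /\ (cost a' = cost a -> a' = center_update d M y sel a)).
Proof.
  intros Hw Hf a'. unfold a'. rewrite iteration_eq.
  set (s1 := center_update d M y sel a).
  destruct (center_update_invariants a Hw) as [W1 F1]. fold s1 in W1, F1.
  assert (C1 : (length (centers s1) <= length (centers a))%nat) by apply centers_map.
  assert (K1 : cost s1 <= cost a) by (apply center_update_cost; auto).
  destruct (merge_loop_props M s1 W1 F1) as [W2 [F2 [C2 S2]]].
  destruct (cluster_update_invariants _ W2 F2) as [_ [_ C3]].
  split; [lia|]. intros Heq.
  assert (E : eligible d dth y s1 = []).
  { destruct (eligible d dth y s1) eqn:E; auto. exfalso. assert (H := S2 ltac:(congruence) M_pos). lia. }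
  rewrite (merge_loop_no_eligible M s1 E) in *.
  destruct (cluster_update_cost s1 (proj1 W1)) as [K3 S3].
  split; [lra|]. intros Hc. apply NNPP. intros Hn. specialize (S3 Hn). lra.
Qed.

Lemma grow_bounded f cs : (forall x, In x cs -> (x < M)%nat) ->
  forall x, In x (grow d dth M y sel f cs) -> (x < M)%nat.
Proof.
  revert cs. induction f as [|f IH]; intros cs Hb; simpl; auto.
  destruct existsb; auto. apply IH. intros x Hx. apply in_app_or in Hx. destruct Hx as [Hx|[<-|[]]]; auto.
  apply in_idx, (sel_argmax sel CInitMax _ (idx M) sel_good (idx_nonempty M M_pos)).
Qed.

Lemma grow_nonempty f cs : cs <> [] -> grow d dth M y sel f cs <> [].
Proof.
  revert cs. induction f as [|f IH]; intros cs H; simpl; auto.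
  destruct existsb; auto. apply IH. destruct cs; simpl; congruence.
Qed.

Lemma init_state_well_formed : well_formed M (init_state d dth M y sel).
Proof.
  unfold init_state. split; [rewrite length_map; apply length_seq|].
  intros x Hx. apply in_map_iff in Hx. destruct Hx as [i [<- _]].
  assert (Hc : forall x, In x (init_centers d dth M y sel) -> (x < M)%nat).
  { apply grow_bounded. intros x [<-|[]]. apply in_idx, sel_good, idx_nonempty, M_pos. }
  apply Hc, (sel_argmin sel (CAssign i) _ _ sel_good), grow_nonempty. congruence.
Qed.

Lemma run_S T : run d dth M y sel selp (S T) = iteration d dth M y sel selp (run d dth M y sel selp T).
Proof. reflexivity. Qed.

(* The run eventually repeats a state; on the cycle the number of clusters and
   the cost stay constant, so each step is a centre update, which is idempotent. *)
Theorem algorithm_terminates :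
  exists N, iteration d dth M y sel selp (run d dth M y sel selp N) = run d dth M y sel selp N.
Proof.
  set (s := fun m => run d dth M y sel selp (S m)).
  assert (HsS : forall m, s (S m) = iteration d dth M y sel selp (s m)) by reflexivity.
  assert (Hinv : forall m, well_formed M (s m) /\ centred M (s m)).
  { intros m. unfold s. rewrite run_S. apply iteration_invariants.
    induction m as [|m IH]; [apply init_state_well_formed | rewrite run_S; apply iteration_invariants, IH]. }
  destruct (well_formed_repeat M s (fun m => proj1 (Hinv m))) as [i [j [Hij Heq]]].
  assert (Hstep := fun m => iteration_descent (s m) (proj1 (Hinv m)) (proj2 (Hinv m))).
  simpl in Hstep. setoid_rewrite <- HsS in Hstep.
  assert (Hcnt : forall m, (i <= m < j)%nat -> length (centers (s (S m))) = length (centers (s m))).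
  { intros m Hm. apply INR_eq. revert m Hm.
    apply (nonincreasing_cycle (fun m => INR (length (centers (s m))))); [|rewrite Heq; auto].
    intros m _. apply le_INR, Hstep. }
  assert (Hcu : forall m, (i <= m < j)%nat -> s (S m) = center_update d M y sel (s m)).
  { intros m Hm. apply (proj2 (Hstep m) (Hcnt m Hm)). revert m Hm.
    apply (nonincreasing_cycle (fun m => cost (s m))); [|rewrite Heq; auto].
    intros m Hm. apply (proj2 (Hstep m) (Hcnt m Hm)). }
  destruct (Nat.eq_dec j (S i)) as [->|Hj].
  - exists (S i). fold (s i). rewrite <- HsS. auto.
  - exists (S (S i)). fold (s (S i)). rewrite <- HsS, (Hcu (S i)), (Hcu i) by lia.
    apply center_update_idem, Hinv.
Qed.

End Algorithm.

Section SeparatedData.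
Context {X : Type}.
Variables (d : X -> X -> R) (dth : R) (M K : nat) (lab : nat -> nat) (y : nat -> X).
Variables (sel : choice_point -> list nat -> nat) (selp : list (nat * nat) -> nat * nat).
Hypothesis sel_good : sel_ok sel.
Hypothesis M_pos : (0 < M)%nat.
Hypothesis lab_lt : forall i, (i < M)%nat -> (lab i < K)%nat.

Definition separated : Prop :=
  forall i i', (i < M)%nat -> (i' < M)%nat ->
    (lab i <> lab i' -> dth < d (y i) (y i')) /\ (lab i = lab i' -> d (y i) (y i') <= dth).

Hypothesis sep : separated.

Definition respects_labels (a : list nat) : Prop :=
  length a = M /\ forall i, (i < M)%nat ->
    (cur a i < M)%nat /\ lab (cur a i) = lab i /\
    forall j, (j < M)%nat -> lab j = lab i -> cur a j = cur a i.

Lemma respects_labels_correct a :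
  (forall k, (k < K)%nat -> exists i, (i < M)%nat /\ lab i = k) ->
  respects_labels a -> correct_partition M K lab a.
Proof.
  intros Hcov [Hl HG].
  assert (Hclass : forall i, (i < M)%nat -> forall j, (j < M)%nat -> (cur a j = cur a i <-> lab j = lab i)).
  { intros i Hi j Hj. destruct (HG i Hi) as [_ [_ H3]]. destruct (HG j Hj) as [_ [H2' _]].
    split; [intros E; rewrite <- H2', E; apply HG; auto | apply H3; auto]. }
  split.
  - intros c Hc. destruct (cur_onto M a c Hl Hc) as [i [Hi <-]]. exists (lab i).
    split; [apply lab_lt; auto | exact (Hclass i Hi)].
  - intros k Hk. destruct (Hcov k Hk) as [i [Hi <-]]. exists (cur a i).
    split; [apply (In_cur M); auto | exact (Hclass i Hi)].
Qed.

(* On separated data the initialisation loop picks one centre per label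
   (a new centre is farther than [dth] from all previous ones, hence has a
   new label) and stops only when every label is represented; [K < |cs| + f]
   guarantees that the fuel [f] is sufficient. *)
Lemma grow_separated f cs :
  (forall x, In x cs -> (x < M)%nat) -> NoDup (map lab cs) -> cs <> [] -> (K < length cs + f)%nat ->
  let cs' := grow d dth M y sel f cs in
  (forall x, In x cs' -> (x < M)%nat) /\ NoDup (map lab cs') /\
  forall i, (i < M)%nat -> exists c, In c cs' /\ lab c = lab i.
Proof.
  revert cs. induction f as [|f IH]; intros cs Hb Hnd Hne Hlen cs'.
  - exfalso. assert (Hk : (length (map lab cs) <= K)%nat).
    { apply NoDup_bounded_length; auto. intros x Hx. apply in_map_iff in Hx.
      destruct Hx as [c [<- Hc]]. apply lab_lt, Hb; auto. }
    rewrite length_map in Hk. lia.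
  - unfold cs'. simpl. destruct existsb eqn:E.
    + apply existsb_exists in E. destruct E as [i [Hi Hfar]]. rewrite forallb_forall in Hfar.
      set (j := sel CInitMax _).
      destruct (sel_argmax sel CInitMax (fun i0 => minR_list (fun c => d (y i0) (y c)) cs) (idx M)
                  sel_good (idx_nonempty M M_pos)) as [Hj1 Hj2]. fold j in Hj1, Hj2.
      specialize (Hj2 i Hi). apply in_idx in Hj1.
      assert (Hmi : dth < minR_list (fun c => d (y i) (y c)) cs).
      { apply minR_list_gt; auto. intros c Hc. apply Rltb_true, Hfar; auto. }
      assert (Hmj : forall c, In c cs -> dth < d (y j) (y c)).
      { apply (minR_list_gt (fun c => d (y j) (y c))); auto. lra. }
      apply IH.
      * intros x Hx. apply in_app_or in Hx. destruct Hx as [Hx|[<-|[]]]; auto.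
      * rewrite map_app. simpl. eapply Permutation_NoDup; [apply Permutation_cons_append|].
        constructor; auto. intros Hin. apply in_map_iff in Hin. destruct Hin as [c [Hc1 Hc2]].
        specialize (Hmj c Hc2). destruct (sep j c Hj1 (Hb c Hc2)) as [_ H2].
        specialize (H2 (eq_sym Hc1)). lra.
      * destruct cs; simpl; congruence.
      * rewrite length_app. simpl. lia.
    + split; [auto|split; [auto|]]. intros i Hi.
      destruct (classic (exists c, In c cs /\ lab c = lab i)) as [Hc|Hc]; auto.
      exfalso. rewrite <- Bool.not_true_iff_false in E. apply E.
      apply existsb_exists. exists i. split; [apply in_idx; auto|]. apply forallb_forall. intros c Hcs.
      apply Rltb_true. apply (sep i c Hi (Hb c Hcs)). intros E0; apply Hc; exists c; split; auto.
Qed.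

(* On separated data the initialisation returns the true partition: each
   sequence is assigned to the unique initial centre carrying its label,
   the only centre within distance [dth]. *)
Lemma init_respects_labels : (K <= M)%nat -> respects_labels (init_state d dth M y sel).
Proof.
  intros HKM. pose proof (idx_nonempty M M_pos) as Hne.
  assert (H0 : In (sel CFirst (idx M)) (idx M)) by (apply sel_good; auto).
  destruct (grow_separated M [sel CFirst (idx M)]) as [Hb [Hnd Hcov]].
  { intros x [<-|[]]. apply in_idx; auto. } { simpl. repeat constructor; auto. }
  { congruence. } { simpl; lia. }
  fold (init_centers d dth M y sel) in Hb, Hnd, Hcov. set (cs := init_centers d dth M y sel) in *.
  unfold init_state. fold cs.
  assert (Hz : forall i, (i < M)%nat ->
     In (sel (CAssign i) (argmin_set (fun c => d (y i) (y c)) cs)) cs /\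
     lab (sel (CAssign i) (argmin_set (fun c => d (y i) (y c)) cs)) = lab i).
  { intros i Hi. destruct (Hcov i Hi) as [c0 [Hc0 Hl0]].
    destruct (sel_argmin sel (CAssign i) (fun c => d (y i) (y c)) cs sel_good
                ltac:(intros E; rewrite E in Hc0; auto)) as [Hz1 Hz2].
    split; auto. specialize (Hz2 c0 Hc0).
    destruct (sep i c0 Hi (Hb c0 Hc0)) as [_ H2]. specialize (H2 (eq_sym Hl0)).
    apply NNPP. intros Hn. destruct (sep i _ Hi (Hb _ Hz1)) as [H1 _].
    specialize (H1 (not_eq_sym Hn)). lra. }
  split; [rewrite length_map; apply length_seq|].
  intros i Hi. rewrite cur_map_idx by auto. destruct (Hz i Hi) as [Hz1 Hz2].
  split; [apply Hb; auto | split; auto].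
  intros j Hj Hlj. rewrite cur_map_idx by auto. destruct (Hz j Hj) as [Hz1' Hz2'].
  apply (NoDup_map_eq lab cs); auto. congruence.
Qed.

(* The centre update keeps clusters, hence respects the labels. *)
Lemma center_update_respects_labels a :
  respects_labels a -> respects_labels (center_update d M y sel a).
Proof.
  intros [Hl HG].
  assert (Hz : forall i, (i < M)%nat ->
            (cur (center_update d M y sel a) i < M)%nat /\ cur a (cur (center_update d M y sel a) i) = cur a i).
  { intros i Hi. rewrite (cur_center_update d M y sel a i Hl Hi).
    apply (medoid_spec d M y sel sel_good a (cur a i) Hl (In_cur M a i Hl Hi)). }
  split; [rewrite center_update_eq, length_map; auto|].
  intros i Hi. destruct (Hz i Hi) as [Hz1 Hz2]. split; [auto|split].
  - destruct (HG _ Hz1) as [_ [H2 _]]. rewrite <- H2, Hz2. apply HG; auto.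
  - intros j Hj Hlj. rewrite !(cur_center_update d M y sel a) by auto. f_equal. apply HG; auto.
Qed.

(* On separated data, distinct centres of a state respecting the labels have
   distinct labels, so no pair of centres is eligible for merging. *)
Lemma respects_labels_no_eligible a : respects_labels a -> eligible d dth y a = [].
Proof.
  intros [Hl HG]. destruct (eligible d dth y a) as [|p ps] eqn:E; auto. exfalso.
  assert (Hin : In p (eligible d dth y a)) by (rewrite E; left; auto).
  pose proof Hin as Hclose. apply eligible_in in Hin. destruct Hin as [Hne [H1 H2]].
  unfold eligible in Hclose. apply filter_In in Hclose. destruct Hclose as [_ Hp].
  apply Bool.andb_true_iff in Hp. destruct Hp as [_ Hp]. apply Rleb_true in Hp.
  destruct (cur_onto M a _ Hl H1) as [i [Hi Ei]]. destruct (cur_onto M a _ Hl H2) as [j [Hj Ej]].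
  destruct (HG i Hi) as [Hi1 [Hi2 Hi3]]. destruct (HG j Hj) as [Hj1 [Hj2 Hj3]].
  destruct (Nat.eq_dec (lab i) (lab j)) as [E'|E'].
  - apply Hne. rewrite <- Ei, <- Ej. symmetry. apply Hi3; auto.
  - rewrite <- Ei, <- Ej in Hp. destruct (sep _ _ Hi1 Hj1) as [Hfar _].
    assert (dth < d (y (cur a i)) (y (cur a j))) by (apply Hfar; rewrite Hi2, Hj2; auto). lra.
Qed.

(* On separated data no sequence finds a strictly closer centre than its own,
   which has its label and is within [dth], whereas other centres are not. *)
Lemma respects_labels_cluster_update a :
  respects_labels a -> cluster_update d M y sel a = a.
Proof.
  intros [Hl HG]. rewrite cluster_update_eq. rewrite <- (map_cur_idx a M Hl) at 2.
  apply map_ext_in. intros i Hi. apply in_idx in Hi. unfold reassign.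
  destruct existsb eqn:E; auto. exfalso.
  apply existsb_exists in E. destruct E as [c [Hc Hlt]]. apply Rltb_true in Hlt.
  unfold centers in Hc; rewrite nodup_In in Hc.
  destruct (cur_onto M a _ Hl Hc) as [j [Hj Ej]].
  destruct (HG i Hi) as [Hi1 [Hi2 Hi3]]. destruct (HG j Hj) as [Hj1 [Hj2 _]].
  destruct (sep i (cur a i) Hi Hi1) as [_ Hdi]. specialize (Hdi (eq_sym Hi2)).
  destruct (Nat.eq_dec (lab i) (lab j)) as [E'|E'].
  - rewrite <- Ej, (Hi3 j Hj (eq_sym E')) in Hlt. lra.
  - rewrite <- Ej in Hlt. destruct (sep i _ Hi Hj1) as [Hfar _].
    assert (dth < d (y i) (y (cur a j))) by (apply Hfar; rewrite Hj2; auto). lra.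
Qed.

Lemma iteration_respects_labels a :
  respects_labels a -> respects_labels (iteration d dth M y sel selp a).
Proof.
  intros Ha. rewrite iteration_eq.
  pose proof (center_update_respects_labels a Ha) as H1.
  rewrite (merge_loop_no_eligible d dth M y selp M _ (respects_labels_no_eligible _ H1)).
  rewrite respects_labels_cluster_update; auto.
Qed.

Lemma run_respects_labels T : (K <= M)%nat -> respects_labels (run d dth M y sel selp T).
Proof.
  intros HKM. induction T as [|T IH]; [apply init_respects_labels; auto|].
  rewrite run_S. apply iteration_respects_labels, IH.
Qed.

End SeparatedData.

Section FinitelyAdditiveProbability.
Context {T : Type} (Pr : charge T).

Lemma mass_ext (A B : T -> Prop) : (forall t, A t <-> B t) -> Pr A = Pr B.
Proof.
  intros H. replace B with A; auto. apply functional_extensionality; intros t.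
  apply propositional_extensionality; auto.
Qed.

Lemma mass_false : Pr (fun _ => False) = 0.
Proof.
  pose proof (mass_add T Pr (fun _ => False) (fun _ => False) (fun _ x _ => x)) as H. cbv beta in H.
  rewrite (mass_ext (fun t => False \/ False) (fun _ => False)) in H by tauto. lra.
Qed.

Lemma mass_split (A B : T -> Prop) : Pr (fun t => A t \/ B t) = Pr A + Pr (fun t => B t /\ ~ A t).
Proof. rewrite <- mass_add by tauto. apply mass_ext. intros t. destruct (classic (A t)); tauto. Qed.

Lemma mass_mono (A B : T -> Prop) : (forall t, A t -> B t) -> Pr A <= Pr B.
Proof.
  intros H. rewrite (mass_ext B (fun t => A t \/ B t)) by firstorder.
  rewrite mass_split. pose proof (mass_nonneg T Pr (fun t => B t /\ ~ A t)). lra.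
Qed.

Lemma mass_union (A B : T -> Prop) : Pr (fun t => A t \/ B t) <= Pr A + Pr B.
Proof. rewrite mass_split. pose proof (mass_mono (fun t => B t /\ ~ A t) B (fun t H => proj1 H)). lra. Qed.

Lemma mass_exists (A : nat -> T -> Prop) l :
  Pr (fun t => exists i, In i l /\ A i t) <= sumR (fun i => Pr (A i)) l.
Proof.
  induction l as [|a l IH].
  - rewrite (mass_ext _ (fun _ => False)) by (intros t; split; [intros [i [[] _]] | tauto]).
    rewrite mass_false. simpl. lra.
  - rewrite (mass_ext _ (fun t => A a t \/ exists i, In i l /\ A i t)).
    + rewrite sumR_cons. pose proof (mass_union (A a) (fun t => exists i, In i l /\ A i t)). lra.
    + intros t; split.
      * intros [i [[<-|Hi] H]]; [left; auto | right; eauto].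
      * intros [H|[i [Hi H]]]; [exists a; split; [left|]; auto | exists i; split; [right|]; auto].
Qed.

Lemma mass_exists_pair (A : nat -> nat -> T -> Prop) l c :
  (forall i i', In i l -> In i' l -> Pr (A i i') <= c) ->
  Pr (fun t => exists i, In i l /\ exists i', In i' l /\ A i i' t) <= INR (length l) ^ 2 * c.
Proof.
  intros H. eapply Rle_trans; [apply mass_exists|].
  eapply Rle_trans; [apply (sumR_le _ (fun _ => INR (length l) * c))|].
  - intros i Hi. eapply Rle_trans; [apply mass_exists|].
    rewrite <- sumR_const. apply sumR_le. intros i' Hi'. apply H; auto.
  - rewrite sumR_const. lra.
Qed.

End FinitelyAdditiveProbability.

Definition pair_violation {Y} (d : Y -> Y -> R) dth (lab : nat -> nat) (y : nat -> Y) i i' : Prop :=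
  (lab i <> lab i' /\ d (y i) (y i') <= dth) \/
  (lab i = lab i' /\ i <> i' /\ d (y i) (y i') > dth).

(* Data without any violating pair are separated, since [d u u <= dth]. *)
Lemma separated_of_no_violation {Y} (d : Y -> Y -> R) dth M lab (y : nat -> Y) :
  (forall u, d u u <= dth) ->
  ~ (exists i, In i (idx M) /\ exists i', In i' (idx M) /\ pair_violation d dth lab y i i') ->
  separated d dth M lab y.
Proof.
  intros Hdd Hn i i' Hi Hi'.
  assert (Hno : ~ pair_violation d dth lab y i i')
    by (intros Hv; apply Hn; exists i; split; [apply in_idx; auto|]; exists i'; split; [apply in_idx; auto | auto]).
  unfold pair_violation in Hno. split.
  - intros Hl. apply Rnot_le_lt. intros Hle. apply Hno. left; auto.
  - intros Hl. apply Rnot_lt_le. intros Hlt. destruct (Nat.eq_dec i i') as [<-|Hii].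
    + specialize (Hdd (y i)). lra.
    + apply Hno. right; auto.
Qed.

Lemma pair_violation_probability {Y Omega} (Pr : charge Omega) M n lab (yr : nat -> Omega -> Y)
  (d : Y -> Y -> R) dth a1 a2 a3 b i i' :
  0 <= a1 -> 0 <= a2 -> assumptionA_bounds Pr M n lab yr d dth a1 a2 a3 b ->
  (i < M)%nat -> (i' < M)%nat ->
  Pr (fun w => pair_violation d dth lab (fun j => yr j w) i i') <= (a1 + a2) * exp (- (b * INR n)).
Proof.
  intros Ha1 Ha2 [HA1 [HA2 _]] Hi Hi'. pose proof (exp_pos (- (b * INR n))) as He.
  eapply Rle_trans; [apply mass_union|]. rewrite Rmult_plus_distr_r. apply Rplus_le_compat.
  - destruct (Nat.eq_dec (lab i) (lab i')) as [El|El].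
    + rewrite (mass_ext Pr _ (fun _ => False)) by tauto. rewrite mass_false. nra.
    + eapply Rle_trans; [apply (mass_mono Pr _ (fun w => d (yr i w) (yr i' w) <= dth)); tauto|].
      apply HA1; auto.
  - destruct (Nat.eq_dec (lab i) (lab i')) as [El|El]; [destruct (Nat.eq_dec i i') as [Ei|Ei]|].
    + rewrite (mass_ext Pr _ (fun _ => False)) by tauto. rewrite mass_false. nra.
    + eapply Rle_trans; [apply (mass_mono Pr _ (fun w => d (yr i w) (yr i' w) > dth)); tauto|].
      apply HA2; auto.
    + rewrite (mass_ext Pr _ (fun _ => False)) by tauto. rewrite mass_false. nra.
Qed.

(* Part (b), in the sharper form M^2 (a1 + a2) e^{-bn}: an incorrect partition
   after T iterations requires non-separated data, hence a violating pair. *)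
Theorem incorrect_partition_probability {Y Omega} (Pr : charge Omega) (n K M : nat) (lab : nat -> nat)
  (yr : nat -> Omega -> Y) (d : Y -> Y -> R) (dth a1 a2 a3 b : R)
  (sel : choice_point -> list nat -> nat) (selp : list (nat * nat) -> nat * nat) :
  (0 < K)%nat ->
  (forall i, (i < M)%nat -> (lab i < K)%nat) ->
  (forall k, (k < K)%nat -> exists i, (i < M)%nat /\ lab i = k) ->
  (forall u, d u u <= dth) -> 0 <= a1 -> 0 <= a2 ->
  assumptionA_bounds Pr M n lab yr d dth a1 a2 a3 b -> sel_ok sel ->
  forall T : nat,
    Pr (fun w => ~ correct_partition M K lab (run d dth M (fun i => yr i w) sel selp T))
    <= INR M ^ 2 * (a1 + a2) * exp (- (b * INR n)).
Proof.
  intros HK HlabK Hcov Hdd Ha1 Ha2 HA Hsel T.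
  destruct (Hcov 0%nat HK) as [i0 [Hi0 _]]. assert (HM : (0 < M)%nat) by lia.
  assert (HKM : (K <= M)%nat).
  { rewrite <- (length_seq K 0), <- (length_seq M 0), <- (length_map lab (seq 0 M)).
    apply NoDup_incl_length; [apply seq_NoDup|]. intros k Hk. apply in_seq in Hk.
    destruct (Hcov k ltac:(lia)) as [i [Hi <-]]. apply in_map, in_seq. lia. }
  assert (Hbad : forall w, ~ correct_partition M K lab (run d dth M (fun i => yr i w) sel selp T) ->
            exists i, In i (idx M) /\ exists i', In i' (idx M) /\
                      pair_violation d dth lab (fun j => yr j w) i i').
  { intros w Hwrong. apply NNPP. intros Hn. apply Hwrong.
    apply (respects_labels_correct M K lab); auto.
    apply (run_respects_labels d dth M K lab); auto. apply separated_of_no_violation; auto. }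
  eapply Rle_trans; [apply (mass_mono Pr _ _ Hbad)|].
  replace (INR M ^ 2 * (a1 + a2) * exp (- (b * INR n)))
    with (INR (length (idx M)) ^ 2 * ((a1 + a2) * exp (- (b * INR n))))
    by (unfold idx; rewrite length_seq; ring).
  apply mass_exists_pair. intros i i' Hi Hi'. apply in_idx in Hi, Hi'.
  apply (pair_violation_probability Pr M n lab yr d dth a1 a2 a3 b); auto.
Qed.

Theorem theorem2 :
  (* (a) termination, for any data *)
  (forall (X : Type) (d : X -> X -> R) (dth : R) (M : nat) (y : nat -> X)
          (sel : choice_point -> list nat -> nat)
          (selp : list (nat * nat) -> nat * nat),
      (0 < M)%nat -> sel_ok sel -> selp_ok selp ->
      (forall u v, d u v = d v u) ->
      (forall u v, d u u <= d u v) ->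
      (forall u, d u u <= dth) ->
      exists N : nat,
        iteration d dth M y sel selp (run d dth M y sel selp N)
        = run d dth M y sel selp N)
  /\
  (* (b) probability of an incorrect partition after T iterations *)
  (forall (S Omega : Type) (Pr : charge Omega) (n K M : nat) (lab : nat -> nat)
          (Pc : nat -> charge S -> Prop) (dP : charge S -> charge S -> R)
          (p : nat -> charge S) (Xs : nat -> nat -> Omega -> S)
          (d : list S -> list S -> R) (dth a1 a2 a3 b : R)
          (sel : choice_point -> list nat -> nat)
          (selp : list (nat * nat) -> nat * nat),
      (0 < K)%nat ->
      (forall i, (i < M)%nat -> (lab i < K)%nat) ->
      (forall k, (k < K)%nat -> exists i, (i < M)%nat /\ lab i = k) ->
      (forall q q', dP q q' = dP q' q) ->
      (forall u v, d u v = d v u) ->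
      (forall u v, d u u <= d u v) ->
      (forall u, d u u <= dth) ->
      (forall i, (i < M)%nat -> Pc (lab i) (p i)) ->
      iid_model Pr M n p Xs ->
      threshold_separates K Pc dP dth ->
      0 <= a1 -> 0 <= a2 -> 0 <= a3 -> 0 < b ->
      assumptionA_bounds Pr M n lab (data n Xs) d dth a1 a2 a3 b ->
      sel_ok sel -> selp_ok selp ->
      forall T : nat,
        Pr (fun w => ~ correct_partition M K lab
                         (run d dth M (fun i => data n Xs i w) sel selp T))
        <= INR M ^ 2 * ((INR T + 1) * a1 + a2 + (INR T + 1) * a3)
           * exp (- (b * INR n))).
Proof.
  split.
  - intros X d dth M y sel selp HM Hsel Hselp Hsym Hself _.
    apply algorithm_terminates; auto.
  - intros S Omega Pr n K M lab _ _ _ Xs d dth a1 a2 a3 b sel selp HK HlabK Hcov _ _ _ Hdd _ _ _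
      Ha1 Ha2 Ha3 _ HA Hsel _ T.
    eapply Rle_trans; [apply (incorrect_partition_probability Pr n K M lab (data n Xs) d dth a1 a2 a3 b); auto|].
    (* the bound obtained is below the one claimed *)
    pose proof (exp_pos (- (b * INR n))). pose proof (pos_INR T).
    apply Rmult_le_compat_r; [lra|]. apply Rmult_le_compat_l; [apply pow2_ge_0|]. nra.
Qed.
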